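(* Let $\eta\in[0,2\pi)$. If a mixed $J(n,k)$, equipped with an $\eta$-function, is periodic, then $n\le k!+k$.
   Context: A mixed graph $G=(V,\mathcal{A})$ consists of a finite vertex set $V$ and a subset $\mathcal{A} \subset V\times V \setminus \{(x,x) \mid x\in V\}$ of arcs. For an arc $a=(x,y)$, write $o(a)=x$, $t(a)=y$, $a^{-1}=(y,x)$. Let $\mathcal{A}^{-1}=\{a^{-1} \mid a\in\mathcal{A}\}$ and $\mathcal{A}^{\pm}=\mathcal{A}\cup\mathcal{A}^{-1}$. The underlying graph $G^{\pm}=(V,\mathcal{A}^{\pm})$ is regarded as an undirected simple graph, and $\deg_G x=\deg_{G^{\pm}}x$. The Johnson graph $J(n,k)$, for positive integers $k<n$, has as vertices the $k$-element subsets of an $n$-element set, two being adjacent when they intersect in exactly $k-1$ elements; it is $k(n-k)$-regular with $\binom{n}{k}$ vertices. A mixed $J(n,k)$ is a mixed graph $G$ such that $G^{\pm}$ is isomorphic to $J(n,k)$. The $\eta$-function $\theta:\mathcal{A}^{\pm}\to\mathbb{R}$ of $G$ is defined by $\theta(a)=\eta$ if $a\in\mathcal{A}\setminus\mathcal{A}^{-1}$, $\theta(a)=-\eta$ if $a\in\mathcal{A}^{-1}\setminus\mathcal{A}$, and $\theta(a)=0$ if $a\in\mathcal{A}\cap\mathcal{A}^{-1}$. Define $K\in\mathbb{C}^{V\times\mathcal{A}^{\pm}}$ by $K_{x,a}=\frac{1}{\sqrt{\deg_G x}}\delta_{x,t(a)}$, $C=2K^*K-I$, $(S_\theta)_{a,b}=e^{\theta(b)i}\delta_{a,b^{-1}}$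 for $a,b\in\mathcal{A}^{\pm}$, and the time evolution matrix $U_\theta=S_\theta C\in\mathbb{C}^{\mathcal{A}^{\pm}\times\mathcal{A}^{\pm}}$. The mixed graph $G$ (equipped with $\theta$) is periodic if there is a positive integer $\tau$ with $U_\theta^{\tau}=I$.
   Formalization: The pair (n,k) = (3,1) is excluded, because the claim fails there: the triangle J(3,1) with all arcs in both directions satisfies U^3 = I and so is periodic, while 3 > 1! + 1. *)

(* Defs.v *)
From HB Require Import structures.
From mathcomp Require Import all_boot all_order all_algebra.
From mathcomp Require Import reals trigo.
From mathcomp Require Import complex.

Set Implicit Arguments.
Unset Strict Implicit.
Unset Printing Implicit Defensive.

Import Order.TTheory GRing.Theory Num.Theory.

Local Open Scope ring_scope.
Local Open Scope complex_scope.
Local Open Scope sesquilinear_scope.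

Record mixed_graph (V : finType) := MixedGraph {
  arcs : {set V * V};
  arcs_irrefl : forall x : V, (x, x) \notin arcs }.

Section Arcs.
Variable V : finType.

Definition terminus (a : V * V) : V := a.2.
Definition inv_arc (a : V * V) : V * V := (a.2, a.1).

Variable G : mixed_graph V.

Definition inv_arcs : {set V * V} := [set inv_arc a | a in arcs G].
Definition sym_arcs : {set V * V} := arcs G :|: inv_arcs.

Definition underlying_adj (x y : V) : bool := (x, y) \in sym_arcs.
Definition deg (x : V) : nat := #|[set y | underlying_adj x y]|.

End Arcs.

(* 'I_n is the ground set; for k > 0 the adjacency below forces X != Y. *)
Definition johnson_vertex (n k : nat) := {X : {set 'I_n} | #|X| == k}.
Definition johnson_adj (n k : nat) (X Y : johnson_vertex n k) : bool :=
  #|val X :&: val Y| == k.-1.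

Definition mixed_johnson (n k : nat) (V : finType) (G : mixed_graph V) : Prop :=
  exists f : V -> johnson_vertex n k,
    bijective f /\
    forall x y : V, underlying_adj G x y = johnson_adj (f x) (f y).

Section TimeEvolution.
Variables (R : realType) (V : finType) (G : mixed_graph V).

(* Defined on all pairs; only its values on sym_arcs G are ever used. *)
Definition eta_function (eta : R) (a : V * V) : R :=
  if a \in arcs G :\: inv_arcs G then eta
  else if a \in inv_arcs G :\: arcs G then - eta
  else 0.

Definition expi (t : R) : R[i] := cos t +i* sin t.

(* Matrices indexed by V and by sym_arcs G are written over ordinals through
   the enumerations of these finite sets. *)

Definition K_mx : 'M[R[i]]_(#|V|, #|sym_arcs G|) :=
  \matrix_(x, a) ((sqrtC (deg G (enum_val x))%:R)^-1
                  * (enum_val x == terminus (enum_val a))%:R).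

Definition coin_mx : 'M[R[i]]_#|sym_arcs G| :=
  2%:R *: (K_mx ^t* *m K_mx) - 1%:M.

Definition shift_mx (theta : V * V -> R) : 'M[R[i]]_#|sym_arcs G| :=
  \matrix_(a, b) (expi (theta (enum_val b))
                  * (enum_val a == inv_arc (enum_val b))%:R).

Definition time_evolution (theta : V * V -> R) : 'M[R[i]]_#|sym_arcs G| :=
  shift_mx theta *m coin_mx.

Definition periodic_walk (theta : V * V -> R) : Prop :=
  exists tau : nat, (0 < tau)%N /\ time_evolution theta ^+ tau = 1%:M.

End TimeEvolution.

(* Main.v *)
Require Import Defs.
From mathcomp Require Import all_boot all_order all_algebra.
From mathcomp Require Import reals trigo.
From mathcomp Require Import separable cyclotomic algC algnum complex.
From mathcomp Require Import ring zify.

Set Implicit Arguments.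
Unset Strict Implicit.
Unset Printing Implicit Defensive.

Import Order.TTheory GRing.Theory Num.Theory.

Local Open Scope ring_scope.

(** If [U ^+ tau = 1], every eigenvalue of [U] is a root of unity, so the second
    elementary symmetric function of the eigenvalues,
    [((\tr U) ^+ 2 - \tr (U *m U)) / 2], is an algebraic integer
    ([trace_integral]).  When the underlying graph is [d]-regular this number
    can be computed from the entries of [U]: there are no loops, so [U] has zero
    diagonal, and the graph is simple, so [U a b * U b a] vanishes unless [b] is
    the inverse of [a]; in that case the two phases cancel and the product is
    [(2 / d - 1) ^+ 2].  Hence [\tr U = 0] and
    [\tr (U *m U) = #|V| d (2 / d - 1) ^+ 2].  A rational algebraic integer is
    an integer, and a parity discussion on [d] turns this into
    [d %| 2 * #|V|] ([regular_periodic_dvdn]).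

    For the Johnson graph, with [m = n - k], this reads
    [k * m %| 2 * 'C(m + k, k)].  Since
    [k`! * 'C(m + k, k) = (m + 1) ... (m + k)] is congruent to [k`!] modulo [m],
    [m] divides [2 * k`!]; so [m > k`!] forces [m = 2 * k`!].  For [k > 1] this
    would make the binomial coefficient [m + k] over [k] a multiple of the even
    number [k`!], whereas it is a product of the odd numbers
    [2 * (k`! / j) + 1], [1 <= j <= k].  For [k = 1] it is the excluded
    triangle. *)

(** * Algebraic integers and matrices of finite order *)

(** The statement about [F] is transported to [algC] because [q] is a root of
    the same monic integral polynomial there, and the rational algebraic
    integers of [algC] are known. *)
Lemma integral_rat_int (F : numFieldType) (q : rat) :
  integralOver (intr : int -> F) (ratr q) -> q \is a Num.int.
Proof.
move=> [p mon_p pq0].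
have ratr_p : map_poly (intr : int -> F) p
    = map_poly ratr (map_poly (intr : int -> rat) p).
  by rewrite -map_poly_comp; apply: eq_map_poly => z /=; rewrite ratr_int.
have rootC : root (map_poly (intr : int -> algC) p) (ratr q).
  have -> : map_poly (intr : int -> algC) p
      = map_poly ratr (map_poly (intr : int -> rat) p).
    by rewrite -map_poly_comp; apply: eq_map_poly => z /=; rewrite ratr_int.
  by rewrite fmorph_root -(fmorph_root (ratr : rat -> F)) -ratr_p.
have Aq : (ratr q : algC) \in Aint.
  apply: root_monic_Aint rootC _ _; first exact: monic_map.
  by apply/polyOverP => i; rewrite coef_map /= intr_int.
have /intrP[z Dz] : (ratr q : algC) \is a Num.int.
  by apply: Cint_rat_Aint => //; apply: Crat_rat.
have -> : q = z%:~R by apply: (fmorph_inj (ratr : rat -> algC)); rewrite /= Dz ratr_int.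
exact: intr_int.
Qed.

(** The witness is the second elementary symmetric function of [s], built by
    recursion: adding [x] to [s] adds [x * \sum_(y <- s) y]. *)
Lemma sqr_sum_integral (K : comNzRingType) (s : seq K) :
  {in s, integralRange (intr : int -> K)} ->
  exists2 c, integralOver (intr : int -> K) c
    & (\sum_(x <- s) x) ^+ 2 = \sum_(x <- s) x ^+ 2 + 2%:R * c.
Proof.
elim: s => [|x s IHs] int_s.
  by exists 0; rewrite ?big_nil ?mulr0 ?addr0 ?expr0n //; apply: integral0.
have int_x : integralOver (intr : int -> K) x by apply: int_s; apply: mem_head.
have {}int_s : {in s, integralRange (intr : int -> K)}.
  by move=> y ys; apply: int_s; rewrite inE ys orbT.
have [c int_c Dc] := IHs int_s.
exists (x * (\sum_(y <- s) y) + c).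
  apply: integral_add int_c; apply: integral_mul int_x _.
  rewrite big_seq; elim/big_ind: _; [exact: integral0 | exact: integral_add |].
  by move=> y /int_s.
rewrite !big_cons sqrrD Dc mulrDr -mulr_natl; ring.
Qed.

(** The minimal polynomial divides ['X^tau - 1], which is separable in
    characteristic zero. *)
Lemma finite_order_diagonal (C : numClosedFieldType) n (M : 'M[C]_n) tau :
  (0 < tau)%N -> M ^+ tau = 1%:M ->
  exists P (d : 'rV[C]_n), [/\ P \in unitmx, P *m M = diag_mx d *m P
    & forall i, d 0 i ^+ tau = 1].
Proof.
move=> tau_gt0; case: n M => [|n] M M_tau.
  by exists 1%:M, 0; split; [exact: unitmx1 | by rewrite [LHS]flatmx0 [RHS]flatmx0 | case].
have [rs Drs] := closed_field_poly_normal ('X^tau - 1 : {poly C}).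
rewrite (monicP (monic_Xn_sub_1 _ tau_gt0)) scale1r in Drs.
have min_dvd : mxminpoly M %| ('X^tau - 1).
  by apply: mxminpoly_min; rewrite rmorphB rmorphXn rmorph1 /= horner_mx_X M_tau subrr.
have: diagonalizable M.
  apply/diagonalizableP; exists rs; last by rewrite -Drs.
  by rewrite -separable_prod_XsubC -Drs separable_Xn_sub_1 // pnatr_eq0 -lt0n.
move=> [P P_unit /diagonalizable_forPex[d M_d]].
exists P, d; split => // [|i]; first exact/(simmxP P_unit).
have : root ('X^tau - 1) (d 0 i).
  apply: root_dvdp min_dvd _.
  rewrite (simmx_minpoly P_unit M_d) mxminpoly_diag root_prod_XsubC mem_undup.
  by apply: map_f; rewrite mem_enum.
by rewrite rootE !hornerE subr_eq0 => /eqP.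
Qed.

(** This is the second elementary symmetric function of the eigenvalues, which
    are roots of unity.  The division by 2 matters: integrality of the trace of
    [M *m M] alone would lose a factor 2 in the final bound. *)
Lemma trace_integral (C : numClosedFieldType) n (M : 'M[C]_n) tau :
  (0 < tau)%N -> M ^+ tau = 1%:M ->
  integralOver (intr : int -> C) (((\tr M) ^+ 2 - \tr (M *m M)) / 2%:R).
Proof.
move=> tau_gt0 M_tau.
have [P [d [P_unit PM d_tau]]] := finite_order_diagonal tau_gt0 M_tau.
have DM : M = invmx P *m diag_mx d *m P by rewrite -mulmxA -PM mulKmx.
have trM : \tr M = \sum_i d 0 i.
  by rewrite DM -mulmxA mxtrace_mulC mulmxK // mxtrace_diag.
have trMM : \tr (M *m M) = \sum_i d 0 i ^+ 2.
  have -> : M *m M = invmx P *m (diag_mx d *m diag_mx d *m P).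
    by rewrite {1}DM -!mulmxA PM.
  rewrite mxtrace_mulC mulmxK // mulmx_diag mxtrace_diag.
  by apply: eq_bigr => i _; rewrite mxE expr2.
have [x /mapP[i _ ->]|c int_c] := @sqr_sum_integral C [seq d 0 i | i <- index_enum 'I_n].
  exists ('X^tau - 1); first exact: monic_Xn_sub_1.
  by rewrite rmorphB rmorph1 /= map_polyXn rootE !hornerE d_tau subrr.
rewrite !big_map trM trMM => ->.
by rewrite addrAC subrr add0r mulrC mulKf // pnatr_eq0.
Qed.

(** * Counting in the Johnson graph *)

Section JohnsonGraph.
Variables n k : nat.

Lemma card_johnson_vertex : #|{: johnson_vertex n k}| = 'C(n, k).
Proof.
by rewrite card_sig -[n in RHS]card_ord -card_draws cardsE; apply: eq_card => A.
Qed.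

(** A neighbour of [X] is obtained by exchanging one element of [X] for one
    element of its complement, and determines the exchanged pair. *)
Lemma card_johnson_neighbours (X : johnson_vertex n k) :
  (0 < k)%N -> #|[set Y | johnson_adj X Y]| = (k * (n - k))%N.
Proof.
move=> k_gt0; case: X => X X_k /=; have /eqP cardX := X_k.
pose swap (p : 'I_n * 'I_n) := p.2 |: (X :\ p.1).
have cardXC : #|~: X| = (n - k)%N by rewrite cardsCs setCK card_ord cardX.
have -> : (k * (n - k))%N = #|setX X (~: X)| by rewrite cardsX cardX cardXC.
(* The exchanged pair is read off from the two set differences. *)
have out p : p \in setX X (~: X) -> X :\: swap p = [set p.1].
  case: p => a b; rewrite inE /= !inE => /andP[aX bX].
  apply/setP=> z; rewrite !inE negb_or negb_and negbK.
  case: (eqVneq z a) => [->|_] /=.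
    by rewrite aX !andbT; apply: contraNneq bX => <-.
  by case: (z \in X); rewrite ?andbF.
have inn p : p \in setX X (~: X) -> swap p :\: X = [set p.2].
  case: p => a b; rewrite inE /= !inE => /andP[aX bX].
  apply/setP=> z; rewrite !inE.
  case: (eqVneq z b) => [->|_]; first by rewrite bX.
  by case: (z \in X); rewrite ?andbF.
have swap_inj : {in setX X (~: X) &, injective swap}.
  move=> p q pX qX epq; have := out p pX; have := inn p pX.
  rewrite epq (out q qX) (inn q qX) => /set1_inj e2 /set1_inj e1.
  by case: p q e1 e2 {pX qX epq} => [? ?] [? ?] /= -> ->.
rewrite -(card_in_imset swap_inj).
rewrite -(card_imset _ val_inj); apply: eq_card => Y.
apply/imsetP/imsetP => [[[Z Z_k] /=]|[[a b]]].
  rewrite inE /johnson_adj /= => /eqP XZ ->.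
  have /eqP cardZ := Z_k.
  have /cards1P[a Da] : #|X :\: Z| == 1%N.
    have := cardsID Z X; rewrite XZ cardX; lia.
  have /cards1P[b Db] : #|Z :\: X| == 1%N.
    have := cardsID X Z; rewrite setIC XZ cardZ; lia.
  have aP : a \in X :\: Z by rewrite Da set11.
  have bP : b \in Z :\: X by rewrite Db set11.
  exists (a, b); first by move: aP bP; rewrite !inE => /andP[_ ->] /andP[-> _].
  by rewrite /swap /= -Da -Db setDDr setDv set0U setIC setUC setID.
rewrite !inE /= => /andP[aX bX] ->.
have cardY : #|swap (a, b)| == k.
  rewrite /swap /= cardsU1 !inE (negPf bX) andbF /=.
  by have := cardsD1 a X; rewrite aX cardX => <-.
exists (exist _ (swap (a, b)) cardY) => //.
rewrite inE /johnson_adj /=.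
have := cardsID (swap (a, b)) X; rewrite out ?inE /= ?inE ?aX //.
by rewrite cards1 addn1 cardX => /(congr1 predn) /= ->.
Qed.

End JohnsonGraph.

(** * Traces of the time evolution of a regular mixed graph *)

Section MixedGraph.
Variables (V : finType) (G : mixed_graph V).

Lemma mem_inv_arcs a : (a \in inv_arcs G) = (inv_arc a \in arcs G).
Proof.
case: a => x y; apply/imsetP/idP => [[[u v] uvG [-> ->]] //|].
by exists (y, x).
Qed.

Lemma inv_arcK : involutive (@inv_arc V). Proof. by case. Qed.

Lemma mem_sym_arcs_inv a : (inv_arc a \in sym_arcs G) = (a \in sym_arcs G).
Proof. by rewrite !inE !mem_inv_arcs inv_arcK orbC. Qed.

Lemma sym_arcs_irrefl x : (x, x) \notin sym_arcs G.
Proof. by rewrite inE mem_inv_arcs /= (negPf (arcs_irrefl G x)). Qed.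

Lemma card_sym_arcs : #|sym_arcs G| = (\sum_x deg G x)%N.
Proof.
rewrite -sum1_card (partition_big fst xpredT) //=; apply: eq_bigr => x _.
rewrite /deg -sum1_card (reindex_onto (fun y => (x, y)) snd) /=; last first.
  by case=> u v /= /andP[_ /eqP->].
by apply: eq_bigl => y; rewrite inE !eqxx !andbT.
Qed.

Lemma eta_function_inv (R : realType) (eta : R) a :
  eta_function G eta (inv_arc a) = - eta_function G eta a.
Proof.
rewrite /eta_function !in_setD !mem_inv_arcs inv_arcK.
by case: (a \in _); case: (_ \in _); rewrite ?oppr0 ?opprK.
Qed.

Lemma expi_mul_opp (R : realType) (t : R) : expi (- t) * expi t = 1.
Proof.
rewrite /expi cosN sinN; apply/eqP; rewrite eq_complex /=.
by have := cos2Dsin2 t; rewrite !expr2 => <-; apply/andP; split; apply/eqP; ring.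
Qed.

Lemma conj_invsqrt_mul (C : numClosedFieldType) (d : nat) (b c : bool) :
  ((sqrtC d%:R)^-1 * b%:R)^* * ((sqrtC d%:R)^-1 * c%:R)
    = d%:R^-1 * (b%:R * c%:R) :> C.
Proof.
rewrite rmorphM fmorphV rmorph_nat /= conj_Creal ?ger0_real ?sqrtC_ge0 ?ler0n //.
by rewrite mulrACA -invfM -expr2 sqrtCK.
Qed.

Section RegularWalk.
Variables (R : realType) (theta : V * V -> R) (d : nat).
Hypothesis theta_inv : forall a, theta (inv_arc a) = - theta a.
Hypothesis G_regular : forall x, deg G x = d.
Let N := #|sym_arcs G|.

Lemma coin_mxE (a b : 'I_N) :
  coin_mx R G a b =
    2%:R / d%:R * (terminus (enum_val a) == terminus (enum_val b))%:R
    - (a == b)%:R.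
Proof.
rewrite !mxE -mulrA; congr (2%:R * _ - _).
under eq_bigr do rewrite !mxE G_regular conj_invsqrt_mul.
rewrite -big_distrr /=; congr (_ * _).
rewrite (reindex enum_rank) /=; last exact: onW_bij (@enum_rank_bij V).
rewrite (bigD1 (terminus (enum_val a))) //= big1 => [|x x_a].
  by rewrite enum_rankK eqxx mul1r addr0.
by rewrite enum_rankK (negPf x_a) mul0r.
Qed.

Lemma ex_inv_index (a : 'I_N) : exists b : 'I_N, enum_val b = inv_arc (enum_val a).
Proof.
have aG := enum_valP a; rewrite -mem_sym_arcs_inv in aG.
by exists (enum_rank_in aG (inv_arc (enum_val a))); rewrite enum_rankK_in.
Qed.

(** The shift has a single nonzero entry in row [a], at the inverse of [a]; the
    row indices are ordinals, so this inverse arc is represented by its own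
    index [a']. *)
Lemma time_evolutionE (a a' c : 'I_N) : enum_val a' = inv_arc (enum_val a) ->
  time_evolution G theta a c = expi (theta (enum_val a')) * coin_mx R G a' c.
Proof.
move=> Da'; rewrite /time_evolution mxE (bigD1 a') //= big1 => [|b ba'].
  by rewrite mxE Da' inv_arcK eqxx mulr1 addr0.
rewrite mxE; case: eqP => [ab|]; last by rewrite mulr0 mul0r.
case/eqP: ba'; apply: enum_val_inj.
by rewrite Da' ab inv_arcK.
Qed.

Lemma time_evolution_diag (a : 'I_N) : time_evolution G theta a a = 0.
Proof.
have [a' Da'] := ex_inv_index a.
have a_loop : (enum_val a).1 != (enum_val a).2.
  have := enum_valP a; case: (enum_val a) => x y /=.
  by apply: contraL => /eqP->; apply: sym_arcs_irrefl.
rewrite (time_evolutionE _ Da') coin_mxE Da' /= (negPf a_loop).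
case: eqP => [aa'|_]; last by rewrite mulr0 subrr mulr0.
by case/eqP: a_loop; move: Da'; rewrite aa'; case: (enum_val a) => x y [].
Qed.

(** A nonzero product needs a walk of length two from the origin of [a] back to
    itself through [a] and [b], which in a simple graph forces [b] to be the
    inverse of [a]; then the phases of [a] and [b] are opposite. *)
Lemma time_evolution_opposite (a b : 'I_N) :
  time_evolution G theta a b * time_evolution G theta b a
    = (enum_val b == inv_arc (enum_val a))%:R * (2%:R / d%:R - 1) ^+ 2.
Proof.
have [a' Da'] := ex_inv_index a; have [b' Db'] := ex_inv_index b.
rewrite (time_evolutionE _ Da') (time_evolutionE _ Db').
case: eqP => [Db|nDb].
  have -> : a' = b by apply: enum_val_inj; rewrite Da'.
  have -> : b' = a by apply: enum_val_inj; rewrite Db' Db inv_arcK.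
  by rewrite Db theta_inv !coin_mxE !eqxx mulrACA expi_mul_opp !mul1r mulr1 expr2.
have a'b : (a' == b) = false by apply/eqP=> a'b; apply: nDb; rewrite -a'b.
have b'a : (b' == a) = false.
  by apply/eqP=> b'a; apply: nDb; rewrite -b'a Db' inv_arcK.
rewrite !coin_mxE a'b b'a Da' Db' /terminus /= mul0r.
case: eqP => [e1|_]; last by rewrite mulr0 subrr mulr0 mul0r.
case: eqP => [e2|_]; last by rewrite mulr0 subrr !mulr0.
by case: nDb; move: e1 e2; case: (enum_val a) => ? ?; case: (enum_val b) => ? ? /= -> ->.
Qed.

Lemma trace_time_evolution : \tr (time_evolution G theta) = 0.
Proof. by apply: big1 => a _; apply: time_evolution_diag. Qed.

Lemma trace_sqr_time_evolution :
  \tr (time_evolution G theta *m time_evolution G theta)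
    = #|V|%:R * d%:R * (2%:R / d%:R - 1) ^+ 2.
Proof.
have <- : N%:R = #|V|%:R * d%:R :> R[i].
  rewrite -natrM; congr _%:R; rewrite /N card_sym_arcs.
  by under eq_bigr do rewrite G_regular; rewrite sum_nat_const.
rewrite /mxtrace -[N in RHS]card_ord -sumr_const big_distrl /=.
apply: eq_bigr => a _; rewrite mxE mul1r.
have [a' Da'] := ex_inv_index a.
rewrite (bigD1 a') //= big1 => [|b ba']; rewrite time_evolution_opposite.
  by rewrite Da' eqxx mul1r addr0.
case: eqP => [Db|]; last by rewrite mul0r.
by case/eqP: ba'; apply: enum_val_inj; rewrite Da'.
Qed.

(** Writing [v] for [#|V|], integrality of the second symmetric function says
    that [2 * d] divides [v * (d - 2) ^ 2].  If [d] is odd it divides [4 * v],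
    hence [v]; if [d = 2 * e], then [e] divides [v * (e - 1) ^ 2], hence
    [v], as [e] is coprime to [e - 1]. *)
Lemma regular_periodic_dvdn :
  (0 < d)%N -> periodic_walk G theta -> (d %| 2 * #|V|)%N.
Proof.
move=> d_gt0 [tau [tau_gt0 U_tau]].
have d0 : d%:R != 0 :> rat by rewrite pnatr_eq0 -lt0n.
pose q : rat := - (#|V|%:R * d%:R * (2%:R / d%:R - 1) ^+ 2 / 2%:R).
have /integral_rat_int/intrP[z Dz] :
    integralOver (intr : int -> R[i]) (ratr q).
  have := trace_integral tau_gt0 U_tau.
  rewrite trace_time_evolution trace_sqr_time_evolution expr0n sub0r mulNr.
  by rewrite /q !(rmorphN, rmorphM, rmorphXn, rmorphB, fmorphV, rmorph_nat, rmorph1).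
have zE : #|V|%:Z * (d%:Z - 2) ^+ 2 = - (2 * z * d%:Z).
  apply: (@intr_inj rat).
  rewrite !(rmorphN, rmorphM, rmorphXn, rmorphB) /= -Dz /q -!pmulrn.
  by field.
have [d_odd|d_even] := boolP (odd d).
  (* (d - 2) ^ 2 = d * (d - 4) + 4 *)
  have d_dvd4 : (d %| 4 * #|V|)%N.
    have: (d%:Z %| (4 * #|V|)%N%:Z)%Z.
      apply/dvdzP; exists (- 2 * z - #|V|%:Z * (d%:Z - 4)).
      rewrite PoszM; move: zE; lia.
    by rewrite dvdzE.
  rewrite dvdn_mull // -(@Gauss_dvdr _ 4) //.
  by rewrite coprime_sym (@coprimeXl 2 2) // coprime2n.
have Dd : d = (2 * d./2)%N by rewrite mul2n even_halfK.
rewrite Dd dvdn_pmul2l //.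
have: (d./2%:Z %| #|V|%:Z)%Z.
  (* With e = d / 2, the cofactor comes from (e - 1) ^ 2 = e * (e - 2) + 1. *)
  apply/dvdzP; exists (- z - #|V|%:Z * d./2%:Z + 2 * #|V|%:Z).
  move: zE; rewrite {1 2}Dd !PoszM; lia.
by rewrite dvdzE.
Qed.

End RegularWalk.
End MixedGraph.

(** * Arithmetic of the divisibility condition *)

Lemma ffact_mod m k : (m + k) ^_ k = k`! %[mod m].
Proof.
rewrite -ffactnn !ffact_prod.
elim/big_ind2: _ => // [x1 x2 y1 y2 Hx Hy|i _].
  by rewrite -modnMm Hx Hy modnMm.
by rewrite -addnBA ?modnDl // ltnW.
Qed.

(** Multiplying by [k`!], each factor [2 * k`! + j] of the falling factorial,
    with [1 <= j <= k], is [j] times the odd number [2 * (k`! / j) + 1]. *)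
Lemma odd_bin_double_fact k : odd 'C(2 * k`! + k, k).
Proof.
suff -> : 'C(2 * k`! + k, k) = (\prod_(i < k) (2 * (k`! %/ (k - i))).+1)%N.
  by elim/big_ind: _ => // [x y ox oy|i _]; rewrite ?oddM ?ox //= oddM.
apply/eqP; rewrite -(eqn_pmul2r (fact_gt0 k)) bin_ffact; apply/eqP.
rewrite -{3}ffactnn !ffact_prod -big_split /=; apply: eq_bigr => i _.
rewrite [RHS]mulSn [RHS]addnC -mulnA divnK ?addnBA 1?ltnW //.
by apply: dvdn_fact; rewrite subn_gt0 ltn_ord leq_subr.
Qed.

(** [m] divides [2 * k`!], whose only divisor exceeding [k`!] is itself; the
    hypothesis is then a parity contradiction. *)
Lemma dvdn_bin_bound k m : (0 < k)%N -> (0 < m)%N -> ~ (k = 1%N /\ m = 2%N) ->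
  (k * m %| 2 * 'C(m + k, k))%N -> (m <= k`!)%N.
Proof.
move=> k_gt0 m_gt0 km_neq12 km_dvd; rewrite leqNgt; apply/negP => m_gt.
have: (m %| 2 * k`!)%N.
  have: (m %| 2 * (m + k) ^_ k)%N.
    rewrite -bin_ffact mulnA dvdn_mulr //.
    exact: dvdn_trans (dvdn_mull _ (dvdnn m)) km_dvd.
  by rewrite /dvdn -modnMmr ffact_mod modnMmr.
case/dvdnP => c Dc.
have Dm : m = (2 * k`!)%N.
  by move: c Dc => [|[|c]]; have := fact_gt0 k; nia.
have k_gt1 : (1 < k)%N.
  rewrite ltn_neqAle k_gt0 andbT; apply/eqP => k1; apply: km_neq12.
  by rewrite Dm -k1.
move: km_dvd; rewrite Dm mulnCA dvdn_pmul2l // => /(dvdn_odd)/(_ (odd_bin_double_fact k)).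
apply/negP; rewrite oddM negb_and orbC -dvdn2 dvdn_fact //.
Qed.

(* (n, k) = (3, 1) must be left out: J(3, 1) is the triangle, and for the
   triangle with all arcs in both directions U maps the arc (x, y) to (y, z),
   z being the third vertex, so U ^+ 3 = 1, whereas 3 > 1`! + 1. *)
Theorem proposition9p1 (R : realType) (n k : nat)
    (k_gt0 : (0 < k)%N) (k_lt_n : (k < n)%N)
    (nk_neq31 : ~ (n = 3%N /\ k = 1%N))
    (V : finType) (G : mixed_graph V)
    (eta : R) (eta_ge0 : 0 <= eta) (eta_lt2pi : eta < 2%:R * pi)
    (GJ : mixed_johnson n k G)
    (G_periodic : periodic_walk G (eta_function G eta)) :
  (n <= k`! + k)%N.
Proof.
have [f [f_bij f_adj]] := GJ.
have cardV : #|V| = 'C(n, k) by rewrite (bij_eq_card f_bij) card_johnson_vertex.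
have G_regular x : deg G x = (k * (n - k))%N.
  rewrite /deg -(card_johnson_neighbours (f x)) // -(card_imset _ (bij_inj f_bij)).
  have [g gK fK] := f_bij.
  apply: eq_card => Y; rewrite inE; apply/imsetP/idP => [[y] | XY].
    by rewrite inE f_adj => ? ->.
  by exists (g Y); rewrite ?fK // inE f_adj fK.
have m_gt0 : (0 < n - k)%N by rewrite subn_gt0.
have km_dvd : (k * (n - k) %| 2 * 'C(n, k))%N.
  rewrite -cardV; apply: regular_periodic_dvdn G_regular _ G_periodic.
    exact: eta_function_inv.
  by rewrite muln_gt0 k_gt0.
rewrite addnC -leq_subLR.
apply: dvdn_bin_bound => //; last by rewrite subnK // ltnW.
move=> [k1 m2]; apply: nk_neq31; lia.
Qed.
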